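(* Let $m \geq 0$ and $r \geq 1$ be integers. Let $S_m^{r-1}/S_m$ denote the set of orbits of $S_m$ on $S_m^{r-1}$ under simultaneous conjugation, let $t = |S_m^{r-1}/S_m|$, and choose representatives $\mathbf{s}_1, \dots, \mathbf{s}_t \in S_m^{r-1}$, one from each $S_m$-orbit. Let $\mathbf{n} = (n_1,\dots,n_r)$ be an $r$-tuple of positive integers. If $n_i \geq m$ for all $1 \leq i \leq r$, then the set $$\mathcal{B} = \{ f_{\mathbf{s}_1}, f_{\mathbf{s}_2}, \dots, f_{\mathbf{s}_t} \}$$ is a basis of the space of $G(\mathbf{n})$-invariants in $\mathcal{S}^{2m}(V(\mathbf{n}) \oplus V(\mathbf{n})^* )$. Without the assumption $n_i \geq m$ for all $i$, the set $\mathcal{B}$ still spans this space of invariants.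
   Context: $V(\mathbf{n}) = \mathbb{C}^{n_1} \otimes \cdots \otimes \mathbb{C}^{n_r}$ is the representation of $G(\mathbf{n}) = \mathrm{GL}(n_1,\mathbb{C}) \times \cdots \times \mathrm{GL}(n_r,\mathbb{C})$ given by $(g_1,\dots,g_r)\cdot(v_1\otimes\cdots\otimes v_r) = (g_1v_1)\otimes\cdots\otimes(g_rv_r)$, and $V(\mathbf{n})^*$ is the dual representation, identified with $(\mathbb{C}^{n_1})^*\otimes\cdots\otimes(\mathbb{C}^{n_r})^*$. $\mathcal{S}^{2m}$ denotes the degree $2m$ component of the symmetric algebra. Since $V(\mathbf{n})\oplus V(\mathbf{n})^*$ is self-dual, $\mathcal{S}^{2m}(V(\mathbf{n})\oplus V(\mathbf{n})^* )$ is naturally identified ($G(\mathbf{n})$-equivariantly) with the space of complex homogeneous polynomial functions of degree $2m$ on the complex vector space $V(\mathbf{n})\oplus V(\mathbf{n})^*$. Let $e_1,\dots,e_n$ be the standard basis of $\mathbb{C}^n$ and $e^1,\dots,e^n$ the dual basis. Write a general element of $V(\mathbf{n})\oplus V(\mathbf{n})^*$ as $(X,Y)$ with $X=\sum x^{i_1\cdots i_r}e_{i_1}\otimes\cdots\otimes e_{i_r}$ and $Y=\sum y_{i_1\cdots i_r}e^{i_1}\otimes\cdots\otimes e^{i_r}$, where $x^{i_1\cdots i_r}, y_{i_1\cdots i_r}\in\mathbb{C}$. $S_m$ is the symmetric group on $\{1,\dots,m\}$, acting on $S_m^{r-1}$ by simultaneous conjugation $\tau\cdot(\sigma_1,\dots,\sigma_{r-1})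 = (\tau\sigma_1\tau^{-1},\dots,\tau\sigma_{r-1}\tau^{-1})$. For $\mathbf{s}=(\sigma_1,\dots,\sigma_{r-1})\in S_m^{r-1}$, put $\sigma_r = 1$ (the identity permutation), and let $f_{\mathbf{s}}$ be the polynomial function on $V(\mathbf{n})\oplus V(\mathbf{n})^*$ whose value at $(X,Y)$ is $$f_{\mathbf{s}}(X,Y) = \sum \prod_{j=1}^m x^{i^{(j)}_1\cdots i^{(j)}_r}\; y_{i^{(\sigma_1(j))}_1\cdots i^{(\sigma_r(j))}_r},$$ the sum being over all choices of indices $i^{(j)}_k$ with $1\leq i^{(j)}_k\leq n_k$ for $1\leq j\leq m$, $1\leq k\leq r$. *)

(* Defs.v *)
From mathcomp Require Import all_boot all_order all_algebra all_fingroup.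
From mathcomp Require Export reals complex.
From mathcomp Require Export mpoly.

Set Implicit Arguments.
Unset Strict Implicit.
Unset Printing Implicit Defensive.

Import GRing.Theory.
Local Open Scope ring_scope.

Section LinearFamilies.
Variables (K : fieldType) (V : lmodType K) (t : nat).
Implicit Types (v : 'I_t -> V) (W : V -> Prop).

Definition lin_indep v :=
  forall c : 'I_t -> K, \sum_i c i *: v i = 0 -> forall i, c i = 0.

(* W is exactly the linear span of v; in particular every v i lies in W. *)
Definition spans v W :=
  forall w, W w <-> exists c : 'I_t -> K, w = \sum_i c i *: v i.

Definition is_basis v W := lin_indep v /\ spans v W.

End LinearFamilies.

Section Tensors.
Variables (C : fieldType) (r : nat) (n : 'I_r -> nat).

Definition multi_index := {dffun forall k : 'I_r, 'I_(n k)}.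

(* An element of C^(n_1) (x) ... (x) C^(n_r), or of the dual space, given by
   its coordinates in the basis of tensor products of standard (respectively
   dual) basis vectors. *)
Definition tensor := {ffun multi_index -> C}.

Definition pure_tensor (v : forall k, 'cV[C]_(n k)) : tensor :=
  [ffun i : multi_index => \prod_k v k (i k) 0].

Definition pairing (X Y : tensor) : C := \sum_i X i * Y i.

Definition inGL (g : forall k, 'M[C]_(n k)) := forall k, g k \in unitmx.

Definition tensor_act (g : forall k, 'M[C]_(n k)) (X : tensor) : tensor :=
  [ffun i : multi_index =>
     \sum_(j : multi_index) (\prod_k g k (i k) (j k)) * X j].

(* The contragredient action: each factor acts on row vectors by right
   multiplication with the inverse matrix. *)
Definition dual_tensor_act (g : forall k, 'M[C]_(n k)) (Y : tensor) : tensor :=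
  [ffun i : multi_index =>
     \sum_(j : multi_index) Y j * \prod_k invmx (g k) (j k) (i k)].

Lemma prod_sum_multi_index (F : forall k, 'I_(n k) -> C) :
  \prod_k \sum_(a < n k) F k a = \sum_(i : multi_index) \prod_k F k (i k).
Proof.
pose T k : finType := 'I_(n k); pose P k := [ffun a : T k => F k a].
rewrite (reindex (@dffun_of_fprod _ T)) /=; last first.
  exact/onW_bij/dffun_of_fprod_bij.
transitivity (\sum_(t : fprod T) \prod_(k in 'I_r) P k (t k)).
  rewrite big_fprod.
  rewrite -(@bigA_distr_big_dep _ _ _ _ _ 'I_r _ (tagged_with T)
              (fun k => untag 0 (P k))).
  apply: eq_bigr => k _; rewrite -(big_tag (fun k => P k)).
  by apply: eq_bigr => a _; rewrite ffunE.
by apply: eq_bigr => t _; apply: eq_bigr => k _; rewrite !ffunE.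
Qed.

Lemma tensor_act_pure g v :
  tensor_act g (pure_tensor v) = pure_tensor (fun k => g k *m v k).
Proof.
apply/ffunP=> i; rewrite !ffunE.
under [RHS]eq_bigr => k _ do rewrite mxE.
rewrite prod_sum_multi_index; apply: eq_bigr => j _.
by rewrite ffunE -big_split.
Qed.

Lemma sum_prod_invmx g (l j : multi_index) : inGL g ->
  \sum_(i : multi_index) \prod_k (invmx (g k) (l k) (i k) * g k (i k) (j k))
    = (l == j)%:R.
Proof.
move=> gU.
rewrite -(prod_sum_multi_index (fun k a => invmx (g k) (l k) a * g k a (j k))).
have E k : \sum_a invmx (g k) (l k) a * g k a (j k) = (l k == j k)%:R.
  by have /matrixP/(_ (l k) (j k)) := mulVmx (gU k); rewrite !mxE.
under eq_bigr => k _ do rewrite E.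
have [-> | neq_lj] := eqVneq l j; first by rewrite big1 // => k _; rewrite eqxx.
have [k neq_k] : exists k, l k != j k.
  apply/existsP; rewrite -negb_forall; apply: contra neq_lj => /forallP eq_lj.
  by apply/eqP/ffunP => k; apply/eqP.
by rewrite (bigD1 k) //= (negPf neq_k) mul0r.
Qed.

Lemma pairing_tensor_act g X Y :
  inGL g -> pairing (tensor_act g X) (dual_tensor_act g Y) = pairing X Y.
Proof.
move=> gU; rewrite /pairing.
transitivity (\sum_(i : multi_index) \sum_(j : multi_index)
    \sum_(l : multi_index) X j * Y l *
      \prod_k (invmx (g k) (l k) (i k) * g k (i k) (j k))).
  apply: eq_bigr => i _; rewrite !ffunE mulr_suml; apply: eq_bigr => j _.
  rewrite mulr_sumr; apply: eq_bigr => l _; rewrite big_split /=.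
  by rewrite [_ * X j]mulrC mulrACA; congr (_ * _); exact: mulrC.
rewrite exchange_big; apply: eq_bigr => j _.
rewrite exchange_big (bigD1 j) //= -mulr_sumr sum_prod_invmx // eqxx mulr1.
rewrite big1 ?addr0 // => l neq_lj.
by rewrite -mulr_sumr sum_prod_invmx // (negPf neq_lj) mulr0.
Qed.

(* The polynomial ring has one variable for each coordinate of X (left
   summand) and one for each coordinate of Y (right summand). *)
Definition nvars := #|{: multi_index + multi_index}|.

Definition xvar (i : multi_index) : {mpoly C[nvars]} :=
  'X_(enum_rank (inl i : multi_index + multi_index)).

Definition yvar (i : multi_index) : {mpoly C[nvars]} :=
  'X_(enum_rank (inr i : multi_index + multi_index)).

Definition coords (X Y : tensor) (a : 'I_nvars) : C :=
  match (enum_val a : multi_index + multi_index) with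
  | inl i => X i
  | inr i => Y i
  end.

Definition peval (p : {mpoly C[nvars]}) (X Y : tensor) : C :=
  p.@[coords X Y].

Definition is_invariant (p : {mpoly C[nvars]}) :=
  forall g, inGL g ->
  forall X Y, peval p (tensor_act g X) (dual_tensor_act g Y) = peval p X Y.

Definition invariant_forms (d : nat) (p : {mpoly C[nvars]}) :=
  p \is d.-homog /\ is_invariant p.

End Tensors.

Arguments invariant_forms C {r} n d p.

Section PermutationTuples.
Variables (m r : nat).

Definition perm_tuple := {ffun 'I_r.-1 -> 'S_m}.

(* s ^ tau is the map tau o s o tau^-1. *)
Definition simconj (s : perm_tuple) (tau : 'S_m) : perm_tuple :=
  [ffun k => (s k ^ tau)%g].

Lemma simconj1 : simconj^~ 1%g =1 id.
Proof. by move=> s; apply/ffunP=> k; rewrite ffunE conjg1. Qed.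

Lemma simconjM s : act_morph simconj s.
Proof. by move=> x y; apply/ffunP=> k; rewrite !ffunE conjgM. Qed.

Definition simconj_action := TotalAction simconj1 simconjM.

Definition simconj_orbits : {set {set perm_tuple}} :=
  orbit simconj_action [set: 'S_m] @: [set: perm_tuple].

(* sigma s k is s_(k+1) for k < r - 1, and the identity for k = r - 1. *)
Definition sigma (s : perm_tuple) (k : 'I_r) : 'S_m :=
  if (insub (val k) : option 'I_r.-1) is Some k' then s k' else 1%g.

End PermutationTuples.

Section BasicInvariants.
Variables (C : fieldType) (m r : nat) (n : 'I_r -> nat).

(* The family i stands for (i^(1), ..., i^(m)). *)
Definition fpoly (s : perm_tuple m r) : {mpoly C[nvars n]} :=
  \sum_(i : {ffun 'I_m -> multi_index n})
    \prod_(j < m) (xvar C (i j) * yvar C [ffun k => i (sigma s k j) k]).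

Lemma peval_fpoly s (X Y : tensor C n) :
  peval (fpoly s) X Y =
  \sum_(i : {ffun 'I_m -> multi_index n})
    \prod_(j < m) (X (i j) * Y [ffun k => i (sigma s k j) k]).
Proof.
rewrite /peval /fpoly raddf_sum /=; apply: eq_bigr => i _.
rewrite rmorph_prod; apply: eq_bigr => j _ /=.
by rewrite mevalM !mevalXU /coords !enum_rankK.
Qed.

End BasicInvariants.

(* Main.v *)
Require Import Defs.
From mathcomp Require Import all_boot all_order all_algebra all_fingroup.

Set Implicit Arguments.
Unset Strict Implicit.
Unset Printing Implicit Defensive.

Import GRing.Theory.
Local Open Scope ring_scope.

(* The scalars of one factor force an invariant form of degree 2m to have
   bidegree (m, m), so that it is p(X, Y) = sum_(I, J) A(I, J) X^I Y^J with A
   symmetric in the m indices of I and in those of J; since A is determined by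
   p, it commutes with the operators g (x) ... (x) g on m-fold tensors.  By
   Zariski density of GL these operators span the commutant of the group S_m^r
   permuting, for each k, the m copies of C^(n_k), so A lies in the double
   commutant of S_m^r, that is, in its span by Maschke averaging.  This writes p
   as a combination of the forms attached to tuples (s_1, ..., s_r), and
   permuting the Y factors makes s_r = 1.  When all n_k >= m, the monomial of
   f_s with X-indices (j, ..., j), j < m, occurs in f_s' only if s' is conjugate
   to s, whence the linear independence. *)

(** * Vanishing of polynomials in characteristic zero *)

Section Vanishing.
Variables (C : fieldType) (pchar0 : [pchar C] =i pred0).

Lemma pchar0_natr_eq0 k : (k%:R == 0 :> C) = (k == 0)%N.
Proof. by move/pcharf0P: pchar0 => ->. Qed.

Lemma natr_inj : injective (fun k : nat => k%:R : C).
Proof.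
suff le_inj i j : (i <= j)%N -> i%:R = j%:R :> C -> i = j.
  by move=> i j; case/orP: (leq_total i j) => /le_inj // E /esym/E ->.
move=> le_ij /eqP; rewrite eq_sym -subr_eq0 -natrB // pchar0_natr_eq0 subn_eq0 => le_ji.
by apply/eqP; rewrite eqn_leq le_ij.
Qed.

Lemma poly_horner_eq0 (q : {poly C}) : (forall t, q.[t] = 0) -> q = 0.
Proof.
move=> q0; apply/eqP; apply: contraT => nz_q.
have := @max_poly_roots _ q [seq k%:R | k <- iota 0 (size q)] nz_q.
rewrite size_map size_iota ltnn; apply.
  by apply/allP=> x _; apply/eqP/q0.
by rewrite (map_inj_uniq natr_inj) iota_uniq.
Qed.

(** Reduction modulo [B] isolates the lowest digit; cancelling it and dividing by [B] sets up the
    induction. *)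
Lemma base_expansion_inj B N (a b : 'I_N -> nat) :
    (forall i, a i < B)%N -> (forall i, b i < B)%N ->
  (\sum_(i < N) a i * B ^ i = \sum_(i < N) b i * B ^ i)%N -> a =1 b.
Proof.
elim: N a b => [|N IH] a b aB bB; first by move=> _ [].
rewrite !big_ord_recl !expn0 !muln1.
have shift (c : 'I_N.+1 -> nat) :
    (\sum_(i < N) c (lift ord0 i) * B ^ lift ord0 i
      = (\sum_(i < N) c (lift ord0 i) * B ^ i) * B)%N.
  by rewrite big_distrl; apply: eq_bigr => i _; rewrite /= -mulnA -expnSr.
have B_gt0 : (0 < B)%N by case: B aB {bB shift IH} => // /(_ ord0).
rewrite !shift => E.
have E0 : a ord0 = b ord0.
  by move/(congr1 (modn^~ B)): E; rewrite -!(addnC (_ * B)%N) !modnMDl !modn_small.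
move: E; rewrite E0 => /addnI/eqP; rewrite eqn_pmul2r // => /eqP.
move/(IH (fun i => a (lift ord0 i)) (fun i => b (lift ord0 i))) => E i.
by case: (unliftP ord0 i) => [j ->|-> //]; apply: E.
Qed.

(* Kronecker substitution: the i-th variable is replaced by t ^ (B ^ i) with B
   larger than all exponents, so that distinct monomials stay distinct. *)
Lemma mpoly_meval_eq0 N (p : {mpoly C[N]}) : (forall v, p.@[v] = 0) -> p = 0.
Proof.
move=> p0; pose B := msize p; pose e (m : 'X_{1..N}) := (\sum_i m i * B ^ i)%N.
pose q : {poly C} := \sum_(m <- msupp p) p@_m *: 'X^(e m).
have q0 : q = 0.
  apply: poly_horner_eq0 => t; rewrite -[RHS](p0 (fun i => t ^+ (B ^ i))).
  rewrite mevalE horner_sum; apply: eq_bigr => m _; rewrite hornerZ hornerXn.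
  by congr (_ * _); rewrite -prodrXr; apply: eq_bigr => i _; rewrite -exprM mulnC.
apply/mpolyP=> m; rewrite mcoeff0; apply/eqP; apply: contraT => nz_m.
have ltB m' i : m' \in msupp p -> (m' i < B)%N.
  by move=> /msize_mdeg_lt; apply: leq_trans; rewrite ltnS mdegE (bigD1 i) ?leq_addr.
have m_p : m \in msupp p by rewrite mcoeff_msupp.
suff : q`_(e m) = p@_m by rewrite q0 coef0 => E; rewrite -E eqxx in nz_m.
rewrite coef_sum (bigD1_seq m) ?msupp_uniq //= coefZ coefXn eqxx mulr1.
rewrite big_seq_cond big1 ?addr0 // => m' /andP[m'_p neq_m].
rewrite coefZ coefXn [_ == _]negbTE ?mulr0 //.
apply: contra neq_m => /eqP/base_expansion_inj E; apply/eqP/esym/mnmP => i.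
by apply: E => j; apply: ltB.
Qed.

(** The product [p * q] vanishes at every point, hence is zero, in a domain where [q] is nonzero. *)
Lemma mpoly_meval_dense N (q p : {mpoly C[N]}) v0 : q.@[v0] != 0 ->
  (forall v, q.@[v] != 0 -> p.@[v] = 0) -> p = 0.
Proof.
move=> q_v0 p0; have : p * q = 0.
  apply: mpoly_meval_eq0 => v; rewrite mevalM.
  by have [->|/p0->] := eqVneq q.@[v] 0; rewrite ?mulr0 ?mul0r.
move/eqP; rewrite mulf_eq0 => /orP[/eqP //|/eqP q0].
by rewrite q0 meval0 eqxx in q_v0.
Qed.

Lemma fiber_sum_eq0 N (T : finType) (mu : T -> 'X_{1..N}) (l : T -> C) :
  \sum_t l t *: 'X_[mu t] = 0 -> forall m, \sum_(t | mu t == m) l t = 0.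
Proof.
move=> l0 m; transitivity (\sum_t l t *: 'X_[mu t])@_m; last by rewrite l0 mcoeff0.
rewrite raddf_sum big_mkcond; apply: eq_bigr => t _ /=.
by rewrite mcoeffZ mcoeffX; case: eqP; rewrite ?mulr1 ?mulr0.
Qed.

(** A linear relation among monomials holds on each fibre of [mu], so it survives replacing each
    monomial by a scalar that depends on it alone. *)
Lemma fiber_const_sum_eq0 N (T : finType) (mu : T -> 'X_{1..N}) (l f : T -> C) :
    \sum_t l t *: 'X_[mu t] = 0 -> (forall t u, mu t = mu u -> f t = f u) ->
  \sum_t l t * f t = 0.
Proof.
(* Choosing a representative of each fibre lets the sum be partitioned over the finite type [T]
   instead of the infinite type of monomials. *)
move=> l0 f_mu; pose rep t := odflt t [pick u | mu u == mu t].
have mu_rep t : mu (rep t) = mu t.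
  by rewrite /rep; case: pickP => [u /eqP //|/(_ t)]; rewrite eqxx.
have rep_mu t u : mu t = mu u -> rep t = rep u.
  by rewrite /rep => <-; case: pickP => // /(_ t); rewrite eqxx.
rewrite (partition_big rep xpredT) //= big1 // => t0 _.
rewrite (eq_bigr (fun u => l u * f t0)) => [|u /eqP <-]; last first.
  by congr (_ * _); apply: f_mu.
have [[u0 /eqP <-]|no_u] := altP (@existsP _ (fun u => rep u == t0)).
  rewrite (eq_bigl (fun u => mu u == mu u0)) => [|u].
    by rewrite -mulr_suml fiber_sum_eq0 ?mul0r.
  apply/eqP/eqP => [E|]; last exact: rep_mu.
  by rewrite -mu_rep E mu_rep.
rewrite big_pred0 // => u; apply: contraNF no_u => E; apply/existsP; by exists u.
Qed.

End Vanishing.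

Lemma eq_fibers_perm m (T : finType) (I J : 'I_m -> T) :
  (forall t, #|[set j | I j == t]| = #|[set j | J j == t]|) ->
  exists tau : 'S_m, forall j, J j = I (tau j).
Proof.
move=> IJ; have /tuple_permP[tau E] : perm_eq [tuple J j | j < m] [tuple I j | j < m].
  apply/allP => t _ /=; rewrite !count_map; apply/eqP.
  by have := IJ t; rewrite !cardsE !cardE /enum_mem !size_filter => ->.
exists tau => j.
by have := congr1 (fun s => nth (J j) s j) E; rewrite -!tnth_nth !tnth_mktuple.
Qed.

(** * The double commutant of a finite permutation group *)

Section DoubleCommutant.
Variable C : fieldType.

(** A generalised inverse: on row vectors, [g] followed by [f] is a projection onto the row space of
    [f]. *)
Lemma reflexive_inverse_exists (I J : finType) (f : I -> J -> C) :
  exists g : J -> I -> C,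
  forall a y, \sum_b (\sum_u f a u * g u b) * f b y = f a y.
Proof.
pose S : 'M[C]_(#|I|, #|J|) := \matrix_(i, j) f (enum_val i) (enum_val j).
exists (fun u b => pinvmx S (enum_rank u) (enum_rank b)) => a y.
have /matrixP/(_ (enum_rank a) (enum_rank y)) := mulmxKpV (submx_refl S).
rewrite !mxE !enum_rankK => <-.
rewrite (reindex (@enum_val I I)) /=; last exact/onW_bij/enum_val_bij.
apply: eq_bigr => i _; rewrite !mxE enum_rankK enum_valK; congr (_ * _).
rewrite (reindex (@enum_val J J)) /=; last exact/onW_bij/enum_val_bij.
by apply: eq_bigr => j _; rewrite !mxE enum_rankK !enum_valK.
Qed.

Variables (gT : finGroupType) (T : finType) (to : {action gT &-> T}).

(* Averaging a linear projection onto the span of the operators [to^~ a] over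
   the group gives an equivariant one, whose kernel K satisfies, for fixed v and
   y, the hypothesis made on B.  Commuting A past it shows that A is its own
   projection. *)
Lemma double_commutant (A : T -> T -> C) : #|gT|%:R != 0 :> C ->
    (forall B : T -> T -> C, (forall a x y, B (to x a) (to y a) = B x y) ->
       forall x y, \sum_z A x z * B z y = \sum_z B x z * A z y) ->
  exists c : gT -> C, forall x y, A x y = \sum_a c a * (y == to x a)%:R.
Proof.
move=> nz_g commA.
(* The rows of this matrix are the permutation operators flattened to vectors over [T * T], so [kap]
   gives the coefficients of a projection onto their span. *)
have [kap kapP] := reflexive_inverse_exists
  (fun (a : gT) (p : T * T) => (p.2 == to p.1 a)%:R).
pose K u v x y : C := #|gT|%:R^-1 *
  \sum_a \sum_b kap (to u a, v) b * (y == to (to x a) b)%:R.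
have K_inv v y a x u : K (to u a) v (to x a) y = K u v x y.
  rewrite /K [in RHS](reindex_inj (mulgI a)); congr (_ * _) => /=.
  by apply: eq_bigr => b _; apply: eq_bigr => d _; rewrite !actM.
(* The matrix units at ([to v a], [v]) add up to the operator of [a^-1], which the projection fixes;
   reading it at row [to z a] gives the identity matrix. *)
have K1 z y : \sum_v K v v z y = (y == z)%:R.
  rewrite -mulr_sumr exchange_big /=.
  rewrite (eq_bigr (fun=> (y == z)%:R)) => [|a _].
    by rewrite sumr_const -[X in _ * X]mulr_natl mulrA mulVf ?mul1r.
  have /= E := kapP a^-1%g (to z a, y); rewrite actK in E.
  rewrite exchange_big -E; apply: eq_bigr => b _; rewrite -mulr_suml.
  congr (_ * _).
  transitivity (\sum_u \sum_v (v == to u a^-1%g)%:R * kap (u, v) b); last first.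
    by rewrite pair_bigA; apply: eq_bigr => -[].
  rewrite [RHS] (reindex_inj (act_inj to a)) /=; apply: eq_bigr => v _.
  rewrite (bigD1 v) //= actK eqxx mul1r big1 ?addr0 // => w /negPf-> .
  by rewrite mul0r.
(* The averaging element [a] and the projection index [b] act through their product [d], so [b] is
   [a^-1 * d]. *)
pose c d := #|gT|%:R^-1 * \sum_z \sum_v A z v *
  \sum_a kap (to z a, v) (a^-1 * d)%g.
exists c => x y.
transitivity (\sum_z A x z * \sum_v K v v z y).
  rewrite (bigD1 y) //= K1 eqxx mulr1 big1 ?addr0 // => z.
  by rewrite K1 eq_sym => /negPf->; rewrite mulr0.
under eq_bigr do rewrite mulr_sumr.
rewrite exchange_big /=.
under eq_bigr => v _ do rewrite (commA (fun x u => K u v x y)) //.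
rewrite exchange_big /=.
rewrite /c; under [RHS]eq_bigr => d _.
  rewrite -mulrA mulr_suml mulr_sumr; under eq_bigr => z _.
    rewrite mulr_suml mulr_sumr; over.
  over.
rewrite [RHS]exchange_big; apply: eq_bigr => z _ /=.
rewrite [RHS]exchange_big; apply: eq_bigr => v _ /=.
rewrite /K mulrC mulrCA -mulr_sumr; congr (_ * _).
under [RHS]eq_bigr => d _ do rewrite -mulrA mulr_suml.
rewrite -mulr_sumr; congr (_ * _).
rewrite [RHS]exchange_big; apply: eq_bigr => a _ /=.
rewrite [RHS](reindex_inj (mulgI a)) /=; apply: eq_bigr => b _.
by rewrite mulKg actM.
Qed.

End DoubleCommutant.

(** * Operators on m-fold tensors commuting with the general linear groups *)

Section MultilinearFFT.
Variables (C : fieldType) (pchar0 : [pchar C] =i pred0).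
Variables (m r : nat) (n : 'I_r -> nat).

Local Notation Om := {ffun 'I_m -> multi_index n}.
Local Notation Gam := {dffun forall _ : 'I_r, 'S_m}.

Implicit Types (A B D : Om -> Om -> C) (I J K L P Q : Om) (a b : Gam).

(** The inverse makes this a right action. *)
Definition slot_act I a : Om := [ffun j => [ffun k => I ((a k)^-1%g j) k]].

Lemma slot_act1 : slot_act^~ 1%g =1 id.
Proof.
by move=> I; apply/ffunP => j; apply/ffunP => k; rewrite !ffunE invg1 perm1.
Qed.

Lemma slot_actM I : act_morph slot_act I.
Proof.
move=> a b; apply/ffunP => j; apply/ffunP => k.
by rewrite !ffunE invMg permM.
Qed.

Definition slot_action := TotalAction slot_act1 slot_actM.

(** A matrix entry of the m-th tensor power of the Kronecker product of the [g k]. *)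
Definition tmat (g : forall k, 'M[C]_(n k)) I J : C :=
  \prod_j \prod_k g k (I j k) (J j k).

Lemma eq_tmat g h I J : (forall k, g k = h k) -> tmat g I J = tmat h I J.
Proof. by move=> eq_gh; apply: eq_bigr => j _; apply: eq_bigr => k _; rewrite eq_gh. Qed.

Lemma tmat_slot_act g a I J : tmat g (slot_act I a) (slot_act J a) = tmat g I J.
Proof.
rewrite /tmat exchange_big [RHS]exchange_big; apply: eq_bigr => k _ /=.
rewrite [RHS](reindex_inj (@perm_inj _ (a k)^-1%g)) /=.
by apply: eq_bigr => j _; rewrite !ffunE.
Qed.

Lemma tmat_mulVg g I J : inGL g ->
  \sum_K tmat (fun k => invmx (g k)) I K * tmat g K J = (I == J)%:R.
Proof.
move=> gU.
transitivity (\prod_j \sum_(i : multi_index n)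
    \prod_k (invmx (g k) (I j k) (i k) * g k (i k) (J j k))).
  rewrite bigA_distr_bigA; apply: eq_bigr => K _; rewrite -big_split.
  by apply: eq_bigr => j _; rewrite -big_split.
under eq_bigr do rewrite sum_prod_invmx //.
have [->|neq_IJ] := eqVneq I J; first by rewrite big1 // => j _; rewrite eqxx.
have [j neq_j] : exists j, I j != J j.
  apply/existsP; rewrite -negb_forall; apply: contra neq_IJ => /forallP eq_IJ.
  by apply/eqP/ffunP => j; apply/eqP.
by rewrite (bigD1 j) //= (negPf neq_j) mul0r.
Qed.

Lemma tmat_mulgV g I J : inGL g ->
  \sum_K tmat g I K * tmat (fun k => invmx (g k)) K J = (I == J)%:R.
Proof.
move=> gU; rewrite -(tmat_mulVg (g := fun k => invmx (g k))) => [|k].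
  by apply: eq_bigr => K _; congr (_ * _); apply: eq_tmat => k; rewrite invmxK.
by rewrite unitmx_inv.
Qed.

Let entry : finType := {k : 'I_r & ('I_(n k) * 'I_(n k))%type}.
Let entry_var k (x y : 'I_(n k)) : 'I_#|entry| :=
  enum_rank (Tagged (fun k => 'I_(n k) * 'I_(n k))%type (x, y)).

Let tmat_monom I J : 'X_{1..#|entry|} :=
  (\sum_j \sum_k U_(entry_var (I j k) (J j k)))%MM.

Let tmat_monomE I J k x y :
  tmat_monom I J (entry_var x y) = #|[set j | (I j k, J j k) == (x, y)]|.
Proof.
rewrite mnm_sumE cardsE -sum1_card [RHS]big_mkcond; apply: eq_bigr => j _.
rewrite mnm_sumE (bigD1 k) //= big1 ?addn0 => [|l neq_lk]; rewrite mnm1E.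
  by rewrite (inj_eq enum_rank_inj) eq_Tagged.
rewrite /entry_var (inj_eq enum_rank_inj) [_ == _]negbTE //.
by apply: contra neq_lk => /eqP/(congr1 tag)/= ->.
Qed.

(** For each [k] the exponents count the slots carrying each pair of indices, so the two lists of
    pairs differ by a permutation, chosen separately for each [k]. *)
Let tmat_monom_fiber I J I' J' :
  tmat_monom I J = tmat_monom I' J' ->
  exists a, I' = slot_act I a /\ J' = slot_act J a.
Proof.
move=> eqIJ.
have /fin_all_exists[tau tauP] k : exists tau : 'S_m, forall j,
    (I' j k, J' j k) = (I (tau j) k, J (tau j) k).
  apply: (@eq_fibers_perm _ _ (fun j => (I j k, J j k)) (fun j => (I' j k, J' j k))).
  by move=> [x y]; rewrite -!tmat_monomE eqIJ.
exists [ffun k => (tau k)^-1%g].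
by split; apply/ffunP => j; apply/ffunP => k; rewrite !ffunE invgK; case: (tauP k j).
Qed.

(* The operators [tmat g] span the algebra of operators commuting with all
   permutations of the slots. *)
Lemma tmat_span (l : Om -> Om -> C) B :
    (forall g, inGL g -> \sum_I \sum_J l I J * tmat g I J = 0) ->
    (forall a I J, B (slot_act I a) (slot_act J a) = B I J) ->
  \sum_I \sum_J l I J * B I J = 0.
Proof.
move=> l0 B_inv.
rewrite (pair_bigA _ (fun I J => l I J * B I J)) /=.
(* [B] depends only on the monomial attached to [I] and [J], so it suffices to prove the relation
   for the monomials in the entries of generic matrices. *)
apply: (fiber_const_sum_eq0 (mu := fun p => tmat_monom p.1 p.2)); last first.
  by move=> [I J] [I' J'] /= /tmat_monom_fiber[a [-> ->]].
pose gen k : 'M[{mpoly C[#|entry|]}]_(n k) := \matrix_(x, y) 'X_(entry_var x y).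
pose at_ (v : 'I_#|entry| -> C) k : 'M[C]_(n k) := \matrix_(x, y) v (entry_var x y).
have det_at v : (\prod_k \det (gen k)).@[v] = \prod_k \det (at_ v k).
  rewrite rmorph_prod; apply: eq_bigr => k _; rewrite -det_map_mx; congr (\det _).
  by apply/matrixP => x y; rewrite !mxE /= mevalXU.
(* The point where all matrices are the identity, at which the product of determinants is
   nonzero. *)
pose v1 (i : 'I_#|entry|) : C := ((tagged (enum_val i)).1 == (tagged (enum_val i)).2)%:R.
apply: (mpoly_meval_dense pchar0 (q := \prod_k \det (gen k)) (v0 := v1)).
  rewrite det_at big1 ?oner_eq0 // => k _.
  rewrite (_ : at_ v1 k = 1%:M) ?det1 //.
  by apply/matrixP => x y; rewrite !mxE /v1 enum_rankK.
move=> v; rewrite det_at => nz_det; rewrite raddf_sum /=.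
have gU : inGL (at_ v).
  by move=> k; rewrite unitmxE unitfE; move/prodf_neq0: nz_det => /(_ k isT).
rewrite -[RHS](l0 _ gU) pair_bigA; apply: eq_bigr => -[I J] _ /=.
rewrite mevalZ -mprodXE /= rmorph_prod; congr (_ * _); apply: eq_bigr => j _.
rewrite -mprodXE /= rmorph_prod; apply: eq_bigr => k _.
by rewrite /= mevalXU mxE.
Qed.

(** By the double commutant it suffices that [A] commutes with every slot-invariant [B]; this
    condition is linear in [B], so [tmat_span] reduces it to the operators [tmat g]. *)
Lemma multilinear_FFT A :
    (forall g, inGL g -> forall K M,
       \sum_L A K L * tmat g M L = \sum_I tmat g I K * A I M) ->
  exists c : Gam -> C, forall I J, A I J = \sum_a c a * (J == slot_act I a)%:R.
Proof.
move=> commA; apply: (double_commutant (to := slot_action)).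
  by rewrite (pchar0_natr_eq0 pchar0) -lt0n; apply/card_gt0P; exists 1%g.
move=> B B_inv K M; apply/eqP; rewrite -subr_eq0; apply/eqP.
(* The functional [l] reads the entry ([K], [M]) of the commutator of [A] with the transpose of its
   argument, hence [B J I] below. *)
pose l I J := (I == M)%:R * A K J - (J == K)%:R * A I M.
have delta (G : Om -> C) N : \sum_I (I == N)%:R * G I = G N.
  rewrite (bigD1 N) //= eqxx mul1r big1 ?addr0 // => I /negPf->.
  by rewrite mul0r.
have sum_l (F : Om -> Om -> C) : \sum_I \sum_J l I J * F I J
    = \sum_J A K J * F M J - \sum_I F I K * A I M.
  under eq_bigr => I _.
    under eq_bigr => J _ do rewrite mulrBl -!mulrA.
    rewrite sumrB -mulr_sumr; over.
  rewrite sumrB delta; congr (_ - _).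
  by apply: eq_bigr => I _; rewrite delta mulrC.
rewrite -(sum_l (fun I J => B J I)); apply: tmat_span => [g gU|a I J].
  by rewrite sum_l commA // subrr.
exact: B_inv.
Qed.

End MultilinearFFT.

(** Concatenated constant blocks of lengths [h t] form such a word; this recovers index families
    from an exponent vector. *)
Lemma card_fibers_exists m (T : finType) (h : T -> nat) : (\sum_t h t)%N = m ->
  exists I : {ffun 'I_m -> T}, forall t, #|[set j | I j == t]| = h t.
Proof.
move=> sum_h; pose s := flatten [seq nseq (h t) t | t <- enum T].
have size_s : size s == m.
  rewrite size_flatten /shape -map_comp sumnE big_map big_enum -sum_h.
  by apply/eqP/eq_bigr => t _; rewrite /= size_nseq.
exists [ffun j => tnth (Tuple size_s) j] => t.
transitivity (count_mem t s).
  rewrite -sum1_count -[s]/(val (Tuple size_s)) big_tuple cardsE -sum1_card.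
  by apply: eq_bigl => j; rewrite unfold_in /= ffunE.
rewrite /s count_flatten -map_comp sumnE big_map big_enum (bigD1 t) //=.
rewrite count_nseq /= eqxx mul1n big1 ?addn0 // => u /negPf neq_u.
by rewrite count_nseq /= neq_u.
Qed.

(** * Forms of bidegree (m, m) and their coefficient arrays *)

Section PolynomialsOfTensors.
Variables (C : fieldType) (pchar0 : [pchar C] =i pred0).
Variables (m r : nat) (n : 'I_r -> nat).

Local Notation Om := {ffun 'I_m -> multi_index n}.
Local Notation Gam := {dffun forall _ : 'I_r, 'S_m}.

Implicit Types (A B D : Om -> Om -> C) (I J K L P Q : Om) (a b : Gam).
Implicit Types (p : {mpoly C[nvars n]}) (mu : 'X_{1..nvars n}).

Let lrank i : 'I_(nvars n) := enum_rank (inl i : multi_index n + multi_index n).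
Let rrank i : 'I_(nvars n) := enum_rank (inr i : multi_index n + multi_index n).

Lemma big_nvars (S : Type) (x0 : S) (op : Monoid.com_law x0) (F : 'I_(nvars n) -> S) :
  \big[op/x0]_v F v = op (\big[op/x0]_i F (lrank i)) (\big[op/x0]_i F (rrank i)).
Proof.
rewrite (reindex (@enum_rank (multi_index n + multi_index n)%type)) /=; last first.
  exact/onW_bij/enum_rank_bij.
by rewrite big_sumType.
Qed.

Definition tmon I J : 'X_{1..nvars n} :=
  (\sum_j (U_(lrank (I j)) + U_(rrank (J j))))%MM.

Lemma tmonEl I J i : tmon I J (lrank i) = #|[set j | I j == i]|.
Proof.
rewrite mnm_sumE cardsE -sum1_card [RHS]big_mkcond; apply: eq_bigr => j _.
by rewrite mnmDE !mnm1E !(inj_eq enum_rank_inj) addn0.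
Qed.

Lemma tmonEr I J i : tmon I J (rrank i) = #|[set j | J j == i]|.
Proof.
rewrite mnm_sumE cardsE -sum1_card [RHS]big_mkcond; apply: eq_bigr => j _.
by rewrite mnmDE !mnm1E !(inj_eq enum_rank_inj).
Qed.

Lemma mpolyX_tmon I J :
  'X_[tmon I J] = \prod_j (xvar C (I j) * yvar C (J j)).
Proof. by rewrite -mprodXE; apply: eq_bigr => j _; rewrite mpolyXD. Qed.

Lemma mdeg_tmon I J : mdeg (tmon I J) = (2 * m)%N.
Proof.
rewrite mdeg_sum (eq_bigr (fun=> 2)) => [|j _]; last by rewrite mdegD !mdeg1.
by rewrite sum_nat_const card_ord mulnC.
Qed.

Definition permute I (tau : 'S_m) : Om := [ffun j => I (tau j)].

Lemma permuteK tau : cancel (permute^~ tau) (permute^~ tau^-1%g).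
Proof. by move=> I; apply/ffunP => j; rewrite !ffunE permKV. Qed.

(** The exponents record only multiplicities, separately in X and in Y, so the two families are
    rearranged independently. *)
Lemma tmon_fiber I J I' J' : tmon I J = tmon I' J' ->
  exists tau ups, I' = permute I tau /\ J' = permute J ups.
Proof.
move=> eqIJ; have [tau tauP] : exists tau : 'S_m, forall j, I' j = I (tau j).
  by apply: eq_fibers_perm => i; rewrite -(tmonEl I J) eqIJ tmonEl.
have [ups upsP] : exists ups : 'S_m, forall j, J' j = J (ups j).
  by apply: eq_fibers_perm => i; rewrite -(tmonEr I J) eqIJ tmonEr.
by exists tau, ups; split; apply/ffunP => j; rewrite ffunE.
Qed.

Lemma tmon_permute I J tau ups : tmon (permute I tau) (permute J ups) = tmon I J.
Proof.
rewrite /tmon !big_split /=.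
by congr (_ + _)%MM; [rewrite [RHS](reindex_inj (@perm_inj _ tau))
  | rewrite [RHS](reindex_inj (@perm_inj _ ups))]; apply: eq_bigr => j _; rewrite ffunE.
Qed.

Definition tpoly A : {mpoly C[nvars n]} := \sum_I \sum_J A I J *: 'X_[tmon I J].

(** Many arrays give the same polynomial; this normalisation selects one of them. *)
Definition fiber_const A :=
  forall I J I' J', tmon I J = tmon I' J' -> A I J = A I' J'.

(** Each coefficient of [tpoly D] is a value of [D] times the size of a fibre, which is nonzero in
    characteristic zero. *)
Lemma tpoly_eq0 D : fiber_const D -> tpoly D = 0 -> forall I J, D I J = 0.
Proof.
move=> D_fiber; rewrite /tpoly (pair_bigA _ (fun I J => D I J *: 'X_[tmon I J])) /=.
move=> D0 I J; apply/eqP.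
have := @fiber_sum_eq0 _ _ _ (fun q => tmon q.1 q.2) (fun q => D q.1 q.2) D0 (tmon I J).
rewrite (eq_bigr (fun=> D I J)) => [|[I' J'] /eqP/= /D_fiber //].
rewrite sumr_const -mulr_natl => /eqP; rewrite mulf_eq0 => /orP[|//].
rewrite (pchar0_natr_eq0 pchar0) => /pred0P/(_ (I, J))/negbT/eqP[] //.
Qed.

Lemma peval_tpoly A X Y : peval (tpoly A) X Y =
  \sum_I \sum_J A I J * \prod_j (X (I j) * Y (J j)).
Proof.
rewrite /peval raddf_sum; apply: eq_bigr => I _ /=.
rewrite raddf_sum; apply: eq_bigr => J _ /=.
rewrite mevalZ mpolyX_tmon rmorph_prod; congr (_ * _); apply: eq_bigr => j _ /=.
by rewrite mevalM !mevalXU /coords !enum_rankK.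
Qed.

(** As a matrix, the conjugate of [A] by the transpose of [tmat g]. *)
Definition tconj (g : forall k, 'M[C]_(n k)) A K L :=
  \sum_I \sum_J A I J * (tmat g I K * tmat (fun k => invmx (g k)) L J).

Lemma peval_tpoly_act g A X Y :
  peval (tpoly A) (tensor_act g X) (dual_tensor_act g Y) = peval (tpoly (tconj g A)) X Y.
Proof.
rewrite !peval_tpoly.
transitivity (\sum_I \sum_J \sum_K \sum_L A I J *
    (tmat g I K * tmat (fun k => invmx (g k)) L J) * \prod_j (X (K j) * Y (L j))).
  apply: eq_bigr => I _; apply: eq_bigr => J _.
  rewrite big_split /=.
  under eq_bigr => j _ do rewrite ffunE.
  under [X in _ * (_ * X)]eq_bigr => j _ do rewrite ffunE.
  rewrite !bigA_distr_bigA /= mulr_suml mulr_sumr; apply: eq_bigr => K _.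
  rewrite !mulr_sumr; apply: eq_bigr => L _; rewrite -!mulrA; congr (_ * _).
  by rewrite !big_split /= -!mulrA; congr (_ * _); rewrite mulrA [RHS]mulrC.
transitivity (\sum_K \sum_L \sum_I \sum_J A I J *
    (tmat g I K * tmat (fun k => invmx (g k)) L J) * \prod_j (X (K j) * Y (L j))).
  rewrite (eq_bigr _ (fun I _ => exchange_big _ _ _ _ _ _)) exchange_big /=.
  apply: eq_bigr => K _.
  rewrite (eq_bigr _ (fun I _ => exchange_big _ _ _ _ _ _)) exchange_big /=.
  by [].
apply: eq_bigr => K _; apply: eq_bigr => L _; rewrite mulr_suml.
by apply: eq_bigr => I _; rewrite mulr_suml.
Qed.

Lemma tconj_permute g A I J tau ups :
    (forall I J tau ups, A (permute I tau) (permute J ups) = A I J) ->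
  tconj g A (permute I tau) (permute J ups) = tconj g A I J.
Proof.
move=> A_sym; rewrite /tconj (reindex_inj (can_inj (permuteK tau))) /=.
apply: eq_bigr => K _; rewrite (reindex_inj (can_inj (permuteK ups))) /=.
apply: eq_bigr => L _; rewrite A_sym; congr (_ * (_ * _)).
  rewrite /tmat [RHS](reindex_inj (@perm_inj _ tau)).
  by apply: eq_bigr => j _; apply: eq_bigr => k _; rewrite !ffunE.
rewrite /tmat [RHS](reindex_inj (@perm_inj _ ups)).
by apply: eq_bigr => j _; apply: eq_bigr => k _; rewrite !ffunE.
Qed.

Lemma tpoly_inj A B : fiber_const A -> fiber_const B -> tpoly A = tpoly B ->
  forall I J, A I J = B I J.
Proof.
move=> A_fiber B_fiber eqAB I J; apply/eqP; rewrite -subr_eq0; apply/eqP.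
apply: (@tpoly_eq0 (fun I J => A I J - B I J)) => [I1 J1 I2 J2 E|].
  by rewrite (A_fiber _ _ _ _ E) (B_fiber _ _ _ _ E).
transitivity (tpoly A - tpoly B); last by rewrite eqAB subrr.
rewrite -sumrB; apply: eq_bigr => K _; rewrite -sumrB.
by apply: eq_bigr => L _; rewrite scalerBl.
Qed.

Lemma peval_inj p q : (forall X Y, peval p X Y = peval q X Y) -> p = q.
Proof.
move=> eq_pq; apply/eqP; rewrite -subr_eq0; apply/eqP.
apply: (mpoly_meval_eq0 pchar0) => v; rewrite mevalB; apply/eqP; rewrite subr_eq0.
have := eq_pq [ffun i => v (lrank i)] [ffun i => v (rrank i)].
rewrite /peval !(@meval_eq _ _ (coords _ _) v) => [-> //|w|w];
  by rewrite /coords; case E: (enum_val w) => [i|i];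
     rewrite ffunE /lrank /rrank -E enum_valK.
Qed.

Lemma tensor_act_scalar (c : 'I_r -> C) (X : tensor C n) i :
  tensor_act (fun k => (c k)%:M) X i = (\prod_k c k) * X i.
Proof.
rewrite ffunE (bigD1 i) //= [X in _ + X]big1 ?addr0 => [|j neq_ji].
  by congr (_ * _); apply: eq_bigr => k _; rewrite mxE eqxx.
have [k neq_k] : exists k, i k != j k.
  apply/existsP; rewrite -negb_forall; apply: contra neq_ji => /forallP eq_ij.
  by apply/eqP/ffunP => k; apply/esym/eqP.
by rewrite (bigD1 k) //= mxE (negPf neq_k) !mul0r.
Qed.

Lemma dual_tensor_act_scalar (c : 'I_r -> C) (Y : tensor C n) i :
  dual_tensor_act (fun k => (c k)%:M) Y i = (\prod_k (c k)^-1) * Y i.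
Proof.
rewrite -tensor_act_scalar !ffunE; apply: eq_bigr => j _; rewrite mulrC.
congr (_ * _); apply: eq_bigr => k _.
by rewrite invmx_scalar !mxE eq_sym.
Qed.

(* Let one factor act by the scalar 2 and the others trivially: X is multiplied
   by 2 and Y by 1/2, so only monomials of equal degrees in X and Y survive. *)
Lemma invariant_bidegree p mu : (0 < r)%N -> invariant_forms C n (2 * m) p ->
    mu \in msupp p ->
  (\sum_i mu (lrank i))%N = m /\ (\sum_i mu (rrank i))%N = m.
Proof.
move=> r_gt0 [p_homog p_inv] mu_p.
have nz2 : 2%:R != 0 :> C by rewrite (pchar0_natr_eq0 pchar0).
pose c (k : 'I_r) : C := if k == Ordinal r_gt0 then 2%:R else 1.
have nz_c k : c k != 0 by rewrite /c; case: ifP => _ //; exact: oner_neq0.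
have prod_c : \prod_k c k = 2%:R.
  rewrite (bigD1 (Ordinal r_gt0)) //= big1 => [|k /negPf neq_k].
    by rewrite mulr1 /c eqxx.
  by rewrite /c neq_k.
pose wt (v : 'I_(nvars n)) : C :=
  if enum_val v is inl _ then 2%:R else 2%:R^-1.
(* [q] is [p] with each variable rescaled by its weight; invariance gives [q = p], which forces
   every monomial of [p] to have weight 1. *)
pose q : {mpoly C[nvars n]} :=
  \sum_(nu <- msupp p) (p@_nu * \prod_v wt v ^+ nu v) *: 'X_[nu].
have eq_qp : q = p.
  apply: peval_inj => X Y.
  rewrite -(p_inv (fun k => (c k)%:M)) => [|k]; last first.
    by rewrite unitmxE det_scalar unitfE expf_neq0.
  rewrite /peval [RHS]mevalE /q raddf_sum; apply: eq_bigr => nu _ /=.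
  rewrite mevalZ mevalX -mulrA -big_split; congr (_ * _); apply: eq_bigr => v _.
  rewrite /= -exprMn /wt /coords; congr (_ ^+ _); case: (enum_val v) => i.
    by rewrite tensor_act_scalar prod_c.
  by rewrite dual_tensor_act_scalar prodfV prod_c.
have wt1 : \prod_v wt v ^+ mu v = 1.
  have : q@_mu = p@_mu * \prod_v wt v ^+ mu v.
    rewrite /q raddf_sum (bigD1_seq mu) ?msupp_uniq //= mcoeffZ mcoeffX eqxx mulr1.
    rewrite [X in _ + X]big1 ?addr0 // => nu neq_nu.
    by rewrite mcoeffZ mcoeffX (negPf neq_nu) mulr0.
  rewrite eq_qp -{1}[p@_mu]mulr1 => /mulfI <- //.
  by rewrite -mcoeff_msupp.
have deg_mu : (\sum_i mu (lrank i) + \sum_i mu (rrank i) = 2 * m)%N.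
  by move/dhomogP: p_homog => /(_ _ mu_p) /=; rewrite mdegE big_nvars.
have eq_deg : (\sum_i mu (lrank i))%N = (\sum_i mu (rrank i))%N.
  move: wt1; rewrite big_nvars /wt /=.
  rewrite (eq_bigr (fun i => 2%:R ^+ mu (lrank i))) => [|i _]; last by rewrite enum_rankK.
  rewrite [X in _ * X](eq_bigr (fun i => 2%:R^-1 ^+ mu (rrank i))) => [|i _]; last first.
    by rewrite enum_rankK.
  rewrite !prodrXr exprVn => /divr1_eq; rewrite -!natrX => /(natr_inj pchar0)/eqP.
  by rewrite eqn_exp2l // => /eqP.
by move: deg_mu; rewrite -eq_deg addnn -mul2n => /eqP; rewrite eqn_pmul2l // => /eqP.
Qed.

(** Each coefficient of [p] is shared equally among the pairs of index families giving its monomial;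
    bidegree (m, m) ensures that such pairs exist. *)
Lemma invariant_tpoly p : (0 < r)%N -> invariant_forms C n (2 * m) p ->
  exists2 A, fiber_const A & p = tpoly A.
Proof.
move=> r_gt0 p_inv.
pose fib I J := #|[pred q : Om * Om | tmon q.1 q.2 == tmon I J]|.
exists (fun I J => (fib I J)%:R^-1 * p@_(tmon I J)) => [I J I' J' E|].
  by rewrite /fib E.
apply/mpolyP => mu; rewrite /tpoly.
rewrite (pair_bigA _ (fun I J => ((fib I J)%:R^-1 * p@_(tmon I J)) *: 'X_[tmon I J])).
rewrite raddf_sum /=.
rewrite (eq_bigr (fun q : Om * Om => if tmon q.1 q.2 == mu then
   (fib q.1 q.2)%:R^-1 * p@_mu else 0)) => [|q _]; last first.
  by rewrite mcoeffZ mcoeffX; case: eqP => [->|_]; rewrite ?mulr1 ?mulr0.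
rewrite -big_mkcond /=.
have [mu_p|] := boolP (mu \in msupp p); last first.
  by rewrite mcoeff_msupp negbK => /eqP->; rewrite big1 // => q _; rewrite mulr0.
have [deg_l deg_r] := invariant_bidegree r_gt0 p_inv mu_p.
have [I0 I0P] := card_fibers_exists deg_l.
have [J0 J0P] := card_fibers_exists deg_r.
have mu_IJ : mu = tmon I0 J0.
  apply/mnmP => v; rewrite -[v]enum_valK; case: (enum_val v) => i.
    by rewrite -/(lrank i) tmonEl I0P.
  by rewrite -/(rrank i) tmonEr J0P.
rewrite (eq_bigr (fun=> (fib I0 J0)%:R^-1 * p@_mu)) => [|q /eqP E]; last first.
  by rewrite /fib E mu_IJ.
rewrite sumr_const -[RHS]mulr_natl mulrA mu_IJ divff ?mul1r //.
rewrite (pchar0_natr_eq0 pchar0) -lt0n; apply/card_gt0P; exists (I0, J0).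
exact: eqxx.
Qed.

(** The forms attached to arbitrary [r]-tuples of permutations, before the last one is made
    trivial. *)
Definition slot_poly a : {mpoly C[nvars n]} := \sum_I 'X_[tmon I (slot_act I a)].

Lemma slot_polyE a : slot_poly a = tpoly (fun I J => (J == slot_act I a)%:R).
Proof.
apply: eq_bigr => I _; rewrite (bigD1 (slot_act I a)) //= eqxx scale1r.
by rewrite big1 ?addr0 // => J /negPf->; rewrite scale0r.
Qed.

(** The array of [slot_poly a] is a permutation matrix commuting with every [tmat g], so [tconj]
    leaves it unchanged. *)
Lemma slot_poly_invariant a : invariant_forms C n (2 * m) (slot_poly a).
Proof.
split; first by apply: rpred_sum => I _; rewrite dhomogX /= mdeg_tmon.
move=> g gU X Y; rewrite slot_polyE peval_tpoly_act !peval_tpoly.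
apply: eq_bigr => K _; apply: eq_bigr => L _; congr (_ * _).
transitivity (\sum_I tmat (fun k => invmx (g k)) (slot_act L a^-1%g) I * tmat g I K).
  apply: eq_bigr => I _; rewrite (bigD1 (slot_act I a)) //= eqxx mul1r.
  rewrite big1 ?addr0 => [|J /negPf->]; last by rewrite mul0r.
  rewrite mulrC -[in RHS](tmat_slot_act _ a); congr (tmat _ _ _ * _).
  exact: esym (actKV (slot_action m n) a L).
rewrite tmat_mulVg //; congr (_%:R); congr nat_of_bool.
apply/eqP/eqP => [<-|->]; first exact: esym (actKV (slot_action m n) a L).
exact: actK (slot_action m n) a K.
Qed.

Lemma invariant_slot_poly p : (0 < r)%N -> invariant_forms C n (2 * m) p ->
  exists c : Gam -> C, p = \sum_a c a *: slot_poly a.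
Proof.
move=> r_gt0 p_inv; have [A A_fiber p_A] := invariant_tpoly r_gt0 p_inv.
have A_sym I J tau ups : A (permute I tau) (permute J ups) = A I J.
  by apply: A_fiber; rewrite tmon_permute.
have [|c cP] := @multilinear_FFT _ pchar0 m _ n A.
  move=> g gU K M.
  (* Invariance only equates polynomials; the symmetry of both arrays turns this into equality of
     entries. *)
  have conjA : forall I J, tconj g A I J = A I J.
    apply: tpoly_inj => // [I J I' J' /tmon_fiber[tau [ups [-> ->]]]|].
      by rewrite tconj_permute.
    apply: peval_inj => X Y; rewrite -peval_tpoly_act -p_A.
    by case: p_inv => _; apply.
  (* Multiplying by [tmat g M L] and summing over [L] cancels the inverse in [tconj], leaving only
     the terms with [J = M]. *)
  under eq_bigr => L _ do rewrite -conjA mulr_suml.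
  rewrite exchange_big; apply: eq_bigr => I _ /=.
  under eq_bigr => L _ do rewrite mulr_suml.
  rewrite exchange_big (bigD1 M) //= [X in _ + X]big1 ?addr0 => [|J neq_JM].
    under eq_bigr => L _ do rewrite -!mulrA [_ * tmat g M L]mulrC.
    by rewrite -!mulr_sumr tmat_mulgV // eqxx mulr1 mulrC.
  under eq_bigr => L _ do rewrite -!mulrA [_ * tmat g M L]mulrC.
  by rewrite -!mulr_sumr tmat_mulgV // eq_sym (negPf neq_JM) !mulr0.
exists c; rewrite p_A; under [RHS]eq_bigr do rewrite slot_polyE scaler_sumr.
rewrite exchange_big; apply: eq_bigr => I _ /=.
under [RHS]eq_bigr do rewrite scaler_sumr.
rewrite exchange_big; apply: eq_bigr => J _ /=.
by rewrite cP scaler_suml; apply: eq_bigr => a _; rewrite scalerA.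
Qed.

End PolynomialsOfTensors.

(** * The forms f_s: spanning and linear independence *)

Section BasicInvariantsTheory.
Variables (C : fieldType) (pchar0 : [pchar C] =i pred0).
Variables (m r : nat) (n : 'I_r -> nat).

Local Notation Om := {ffun 'I_m -> multi_index n}.
Local Notation Gam := {dffun forall _ : 'I_r, 'S_m}.
Implicit Types (s : perm_tuple m r) (tau : 'S_m) (I J : Om).

Definition twist s I : Om := [ffun j => [ffun k => I (sigma s k j) k]].

Lemma fpolyE s : fpoly C n s = \sum_I 'X_[tmon I (twist s I)].
Proof.
apply: eq_bigr => I _; rewrite mpolyX_tmon; apply: eq_bigr => j _.
by rewrite ffunE.
Qed.

Lemma sigma_simconj s tau k : sigma (simconj s tau) k = (sigma s k ^ tau)%g.
Proof. by rewrite /sigma; case: insub => [k'|]; rewrite ?ffunE ?conj1g. Qed.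

Lemma twist_permute s tau I :
  twist s (permute I tau) = permute (twist (simconj s tau) I) tau.
Proof.
apply/ffunP => j; apply/ffunP => k.
by rewrite !ffunE sigma_simconj permJ.
Qed.

(** Renaming the m factors by [tau] conjugates every [sigma s k] and merely reorders a commutative
    product. *)
Lemma fpoly_simconj s tau : fpoly C n (simconj s tau) = fpoly C n s.
Proof.
rewrite !fpolyE [RHS](reindex_inj (can_inj (permuteK tau))).
by apply: eq_bigr => I _; rewrite twist_permute tmon_permute.
Qed.

Lemma fpoly_slot_poly s :
  fpoly C n s = slot_poly C n [ffun k => (sigma s k)^-1%g].
Proof.
rewrite fpolyE; apply: eq_bigr => I _; congr 'X_[tmon _ _].
by apply/ffunP => j; apply/ffunP => k; rewrite !ffunE invgK.
Qed.

(* Permuting the Y factors by [a klast] makes the last permutation trivial. *)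
Lemma slot_poly_fpoly (a : Gam) : (0 < r)%N ->
  exists s, slot_poly C n a = fpoly C n s.
Proof.
move=> r_gt0; have last_lt : (r.-1 < r)%N by rewrite ltn_predL.
pose klast := Ordinal last_lt.
pose s : perm_tuple m r :=
  [ffun k => (a klast * (a (widen_ord (leq_pred r) k))^-1)%g].
have sigmaE k : sigma s k = (a klast * (a k)^-1)%g.
  rewrite /sigma; case: insubP => [k' _ /= val_k'|].
    by rewrite ffunE; congr (_ * (a _)^-1)%g; apply: val_inj.
  rewrite -leqNgt => le_k; have -> : k = klast; last by rewrite mulgV.
  by apply/val_inj/eqP; rewrite eqn_leq le_k -ltnS prednK ?ltn_ord.
exists s; rewrite fpolyE; apply: eq_bigr => I _.
rewrite -(tmon_permute _ _ 1%g (a klast)); congr 'X_[tmon _ _].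
  by apply/ffunP => j; rewrite ffunE perm1.
by apply/ffunP => j; apply/ffunP => k; rewrite !ffunE sigmaE permM.
Qed.

Lemma fpoly_invariant s : invariant_forms C n (2 * m) (fpoly C n s).
Proof. by rewrite fpoly_slot_poly; apply: slot_poly_invariant. Qed.

Lemma invariant_fpoly p : (0 < r)%N -> invariant_forms C n (2 * m) p ->
  exists c : perm_tuple m r -> C, p = \sum_s c s *: fpoly C n s.
Proof.
move=> r_gt0 /(invariant_slot_poly pchar0 r_gt0)[c ->].
have /fin_all_exists[f fP] a := slot_poly_fpoly a r_gt0.
exists (fun s => \sum_(a | f a == s) c a).
rewrite (partition_big f xpredT) //=; apply: eq_bigr => s _.
by rewrite scaler_suml; apply: eq_bigr => a /eqP <-; rewrite fP.
Qed.

(** The family with j-th multi-index (j, ..., j); in each tensor factor its m indices are distinct,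
    so they identify the slots. *)
Definition diag_index (le_mn : forall k, (m <= n k)%N) : Om :=
  [ffun j => [ffun k => widen_ord (le_mn k) j]].

Lemma diag_monomial_simconj le_mn s s' I :
    (0 < r)%N ->
    tmon I (twist s' I) = tmon (diag_index le_mn) (twist s (diag_index le_mn)) ->
  exists tau, s = simconj s' tau.
Proof.
move=> r_gt0 /esym/tmon_fiber[tau [ups [I_diag eq_twist]]].
have eq_perm k : (sigma s' k * tau)%g = (ups * sigma s k)%g.
  apply/permP => j; move/ffunP: eq_twist => /(_ j)/ffunP/(_ k).
  rewrite I_diag !permM !ffunE => /(congr1 val) /= eq_val.
  exact: val_inj.
have last_lt : (r.-1 < r)%N by rewrite ltn_predL.
(* At the last index both values of [sigma] are the identity, so [tau = ups] and [eq_perm] becomes a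
   conjugation. *)
have := eq_perm (Ordinal last_lt); rewrite /sigma !insubN -?leqNgt //.
rewrite mul1g mulg1 => eq_tau; exists tau; apply/ffunP => k; rewrite ffunE.
have := eq_perm (widen_ord (leq_pred r) k); rewrite /sigma !valK -eq_tau => E.
by rewrite conjgE E mulKg.
Qed.

(** The coefficient counts index families, the diagonal one among them, and a positive count is
    nonzero in characteristic zero. *)
Lemma mcoeff_diag_monomial le_mn s :
  (fpoly C n s)@_(tmon (diag_index le_mn) (twist s (diag_index le_mn))) != 0.
Proof.
rewrite fpolyE raddf_sum /=; set mu := tmon _ _.
rewrite (eq_bigr (fun I => (tmon I (twist s I) == mu)%:R)) => [|I _]; last first.
  by rewrite mcoeffX.
rewrite -natr_sum (pchar0_natr_eq0 pchar0) (bigD1 (diag_index le_mn)) //=.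
by rewrite eqxx.
Qed.

Variable t : nat.
Implicit Types (b : 'I_t -> perm_tuple m r).

Lemma fpoly_spans b : (0 < r)%N ->
    (forall s, exists i tau, s = simconj (b i) tau) ->
  spans (fun i => fpoly C n (b i)) (invariant_forms C n (2 * m)).
Proof.
move=> r_gt0 b_repr p; split=> [/(invariant_fpoly r_gt0)[c ->]|[c ->]].
  have /fin_all_exists[f fP] s : exists i, fpoly C n s = fpoly C n (b i).
    by have [i [tau ->]] := b_repr s; exists i; rewrite fpoly_simconj.
  exists (fun i => \sum_(s | f s == i) c s).
  rewrite (partition_big f xpredT) //=; apply: eq_bigr => i _.
  by rewrite scaler_suml; apply: eq_bigr => s /eqP <-; rewrite fP.
split; first by apply: rpred_sum => i _; apply/rpredZ/(fpoly_invariant _).1.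
move=> g gU X Y; rewrite /peval !raddf_sum; apply: eq_bigr => i _ /=.
by rewrite !mevalZ; congr (_ * _); apply: (fpoly_invariant _).2.
Qed.

(** The coefficient at the diagonal monomial of [b i] isolates [c i], since no other [b j] is
    conjugate to [b i]. *)
Lemma fpoly_lin_indep b : (0 < r)%N -> (forall k, m <= n k)%N ->
    (forall i j tau, b i = simconj (b j) tau -> i = j) ->
  lin_indep (fun i => fpoly C n (b i)).
Proof.
move=> r_gt0 le_mn b_inj c c0 i; pose I0 := diag_index le_mn.
have := congr1 (mcoeff (tmon I0 (twist (b i) I0))) c0.
rewrite mcoeff0 raddf_sum (bigD1 i) //= [X in _ + X]big1 ?addr0 => [|j neq_ji].
  rewrite mcoeffZ => /eqP; rewrite mulf_eq0 => /orP[/eqP //|].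
  by rewrite (negPf (mcoeff_diag_monomial _ _)).
rewrite mcoeffZ fpolyE raddf_sum big1 ?mulr0 // => I _ /=.
rewrite mcoeffX; case: eqP => // /(diag_monomial_simconj r_gt0)[tau /b_inj E].
by rewrite E eqxx in neq_ji.
Qed.

End BasicInvariantsTheory.

Theorem theorem11 (R : realType) (m r : nat) (hr : (1 <= r)%N)
    (s : 'I_#|simconj_orbits m r| -> perm_tuple m r)
    (hs : forall O, O \in simconj_orbits m r -> exists! a, s a \in O)
    (n : 'I_r -> nat) (hn : forall k, (0 < n k)%N) :
  ((forall k, (m <= n k)%N) ->
     is_basis (fun a => fpoly R[i] n (s a)) (invariant_forms R[i] n (2 * m)))
  /\ spans (fun a => fpoly R[i] n (s a)) (invariant_forms R[i] n (2 * m)).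
Proof.
have pchar0 := Num.Theory.pchar_num R[i].
have orbit_s b : orbit (simconj_action m r) [set: 'S_m] b \in simconj_orbits m r.
  exact: imset_f.
have s_repr b : exists a tau, b = simconj (s a) tau.
  have [a [/orbitP[tau _ eq_sa] _]] := hs _ (orbit_s b).
  exists a, tau^-1%g; rewrite -eq_sa.
  exact/esym/(actK (simconj_action m r)).
have s_inj a b tau : s a = simconj (s b) tau -> a = b.
  (* Both [s a] and [s b] lie in the orbit of [s b], so uniqueness of the representative identifies
     [a] and [b]. *)
  move=> eq_ab; have [a' [_ uniq_a']] := hs _ (orbit_s (s b)).
  have <- : a' = b by apply: uniq_a'; apply: orbit_refl.
  apply: esym; apply: uniq_a'; rewrite eq_ab.
  by apply: (mem_orbit (simconj_action m r)); rewrite inE.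
have spans_s := fpoly_spans (n := n) pchar0 hr s_repr.
by split=> // le_mn; split=> //; apply: fpoly_lin_indep.
Qed.
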